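(* Let $n\ge 2$ and let $D$ be a connected digraph on $[n]$. The following are equivalent: (i) for all $\alpha\in\langle D\rangle$, $\ell(D,\alpha)=n-\mathrm{fix}(\alpha)$; (ii) $D$ is closed and satisfies both of the following properties. Property $(\star)$: whenever $v_0,v_1,v_2$ is a directed path in $D$ with $d_D(v_0,v_2)=2$, one has $N^+(\{v_1,v_2\})\subseteq\{v_0,v_1,v_2\}$. Property $(\star\star)$: for every strong component $C$ of $D$, $|C|\le 2$ if $C$ is nonterminal, and $|C|\le 3$ if $C$ is terminal.
   Context: $[n]=\{1,\dots,n\}$. A digraph has no loops and no multiple edges (both $(a,b)$ and $(b,a)$ may be edges); ''on $[n]$'' means its vertex set is $[n]$. $D$ is connected if its underlying undirected graph is connected. For distinct $a,b\in[n]$, $(a\to b)$ is the transformation of $[n]$ sending $a$ to $b$ and fixing every other point; maps act on the right and products are composed from left to right. $\langle D\rangle$ is the semigroup generated by $\{(a\to b):(a,b)\in E(D)\}$. For $\alpha\in\langle D\rangle$, $\ell(D,\alpha)$ is the minimum length of a word in the generators $(a\to b)$, $(a,b)\in E(D)$, whose product is $\alpha$. $\mathrm{fix}(\alpha)$ is the number of fixed points of $\alpha$. The closure $\bar D$ of $D$ has vertex set $V(D)$ and edge set $E(D)\cup\{(a,b):(b,a)\in E(D)\text{ lies in a directed cycle of }D\}$; $D$ is closed if $D=\bar D$. $d_D(u,v)$ is the length of a shortest directed path from $u$ to $v$ (when one exists). $N^+(v)=\{u:(v,u)\in E(D)\}$ and $N^+(C)=\bigcup_{c\in C}N^+(c)$.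 Vertices of a directed path are pairwise distinct. A strong component $C_1$ is terminal if there is no strong component $C\ne C_1$ with an edge of $D$ from a vertex of $C_1$ to a vertex of $C$; otherwise it is nonterminal. *)

(* Defs.v *)
From mathcomp Require Import all_boot.

Set Implicit Arguments.
Unset Strict Implicit.
Unset Printing Implicit Defensive.

(* A digraph on [n] is an irreflexive relation e : rel 'I_n; the vertex i of
   [n] is the element of 'I_n of value i - 1. *)

Section Transformations.
Variable n : nat.

Definition transf := {ffun 'I_n -> 'I_n}.

Definition arc (a b : 'I_n) : transf := [ffun x => if x == a then b else x].

(* Maps act on the right: the left factor is applied first. *)
Definition tmul (f g : transf) : transf := [ffun x => g (f x)].

Definition tid : transf := [ffun x => x].

Definition tprod (w : seq ('I_n * 'I_n)) : transf :=
  foldl (fun f ab => tmul f (arc ab.1 ab.2)) tid w.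

Definition fix_card (alpha : transf) : nat := #|[set x | alpha x == x]|.

Variable e : rel 'I_n.

Definition product_of_length (alpha : transf) (k : nat) : bool :=
  [exists w : k.-tuple ('I_n * 'I_n),
     all (fun ab => e ab.1 ab.2) w && (tprod w == alpha)].

(* Only nonempty words, since this is the semigroup (not monoid) generated. *)
Definition in_arc_semigroup (alpha : transf) : Prop :=
  exists k, (0 < k) && product_of_length alpha k.

Definition word_length (alpha : transf) (h : in_arc_semigroup alpha) : nat :=
  ex_minn h.

End Transformations.

Section Digraphs.
Variables (n : nat) (e : rel 'I_n).

Definition connected_digraph : Prop :=
  forall x y, connect (fun u v => e u v || e v u) x y.

(* The bound on the length k of the cycle is harmless: a sequence of distinct
   vertices has at most n terms.  For e irreflexive, k is at least 2. *)
Definition on_dicycle (a b : 'I_n) : bool :=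
  [exists k : 'I_n.+1, [exists c : k.-tuple 'I_n,
     [&& ucycleb e c, a \in c & next c a == b]]].

Definition digraph_closure : rel 'I_n :=
  fun a b => e a b || (e b a && on_dicycle b a).

Definition closed_digraph : Prop := e =2 digraph_closure.

Definition dipath (u : 'I_n) (p : seq 'I_n) : bool := path e u p && uniq (u :: p).

(* d_D(u, v) exists and is equal to k. *)
Definition is_dist (u v : 'I_n) (k : nat) : Prop :=
  (exists p, [/\ dipath u p, last u p = v & size p = k]) /\
  (forall p, dipath u p -> last u p = v -> k <= size p).

Definition out_nbrs (C : {set 'I_n}) : {set 'I_n} :=
  \bigcup_(c in C) [set u | e c u].

Definition strong_components : {set {set 'I_n}} :=
  equivalence_partition (fun x y => connect e x y && connect e y x) [set: 'I_n].

Definition terminal (C1 : {set 'I_n}) : Prop :=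
  ~ exists C, [/\ C \in strong_components, C != C1 &
      exists u v, [/\ u \in C1, v \in C & e u v]].

Definition star_property : Prop :=
  forall v0 v1 v2, dipath v0 [:: v1; v2] -> is_dist v0 v2 2 ->
    out_nbrs [set v1; v2] \subset [set v0; v1; v2].

Definition star_star_property : Prop :=
  forall C, C \in strong_components ->
    (~ terminal C -> #|C| <= 2) /\ (terminal C -> #|C| <= 3).

End Digraphs.

(* Main.v *)
Require Import Defs.
From mathcomp Require Import all_boot zify.

(** A word is read as a sequence of token moves: one token starts at each
    vertex, the letter (a -> b) moves every token standing at a to b, and the
    product sends x to the final vertex of the token of x.  Tokens that meet
    stay together.  The first letter that moves the token of x has source x, so
    a word for [alpha] has at least as many letters as [alpha] has moved points
    ([card_nonfixed_le]); the theorem asks when this bound is attained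
    throughout the semigroup.

    Necessity.  If (b -> a) lies on a directed cycle with k vertices, let s be
    (b -> a) followed by the remaining arcs of the cycle from the last to the
    first; then s ^ (k - 1) = (a -> b), a product that moves a single point, so
    (a, b) must itself be an arc ([arc_of_dicycle]).  For the other two
    properties, tokens with distinct final vertices are moved by disjoint sets
    of letters ([sum_moves_le]), and a token needs at least two moves to reach a
    vertex to which there is no arc.  If (star) fails one can drive the tokens
    of v0 and v1 apart in a way that costs too many moves ([tight_star]).  If
    (star star) fails, some component contains a path or a triangle on three
    vertices from which an arc escapes; a path contradicts (star), and in a
    triangle one swaps two tokens while the third one escapes
    ([tight_triangle]).

    Sufficiency.  Every product satisfies three conditions, together called
    [peelable]: a token ends at its start, at an out-neighbour, or at an
    out-neighbour of an out-neighbour m whose token has the same destination;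
    two tokens are swapped only if one of them can be parked at a third vertex
    whose token has the same destination; and there is no 3-cycle.  This is
    proved by prefixing one arc at a time ([peelable_tprod]).  Conversely, any
    map f with these properties other than the identity factors as (a -> b)
    followed by the map that agrees with f except that it fixes a, where f a = f
    b, and a, b can be chosen such that the new map is peelable again ([peel]).
    Each step uses one letter and removes one moved point, which yields a word
    attaining the bound ([peelable_word]). *)

(** * Words and token moves *)

Section Words.
Set Implicit Arguments.
Unset Strict Implicit.
Unset Printing Implicit Defensive.
Variables (n : nat) (e : rel 'I_n).
Implicit Types (w : seq ('I_n * 'I_n)) (x y : 'I_n) (f : transf n).

Definition arc_word w := all (fun ab => e ab.1 ab.2) w.

Definition nonfixed f : {set 'I_n} := [set x | f x != x].

Lemma sub_fix_card f : n - fix_card f = #|nonfixed f|.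
Proof.
rewrite /fix_card -{1}(card_ord n) -(cardsC [set x | f x == x]) addKn.
by apply: eq_card => x; rewrite !inE.
Qed.

Lemma tprod_nil x : tprod [::] x = x :> 'I_n.
Proof. by rewrite ffunE. Qed.

Lemma foldl_tmulE f w x :
  foldl (fun f ab => tmul f (Defs.arc ab.1 ab.2)) f w x = tprod w (f x).
Proof.
rewrite /tprod; elim: w f x => [|ab w IHw] f x /=; first by rewrite ffunE.
by rewrite IHw [in RHS]IHw !ffunE.
Qed.

Lemma tprod_cons a b w x :
  tprod ((a, b) :: w) x = tprod w (if x == a then b else x).
Proof. by rewrite {1}/tprod /= foldl_tmulE !ffunE. Qed.

Lemma tprod_cat u w x : tprod (u ++ w) x = tprod w (tprod u x).
Proof. by rewrite {1}/tprod foldl_cat foldl_tmulE. Qed.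

Lemma tprod_flatten_nseq k w x :
  tprod (flatten (nseq k w)) x = iter k (tprod w) x.
Proof.
by elim: k x => [|k IHk] x; rewrite ?tprod_nil //= tprod_cat IHk -iterSr.
Qed.

Lemma mem_sources w x : tprod w x != x -> x \in map fst w.
Proof.
elim: w => [|[a b] w IHw] /=; first by rewrite tprod_nil eqxx.
by rewrite tprod_cons inE; case: (x == a).
Qed.

Lemma nonfixed_le_size f (s : seq 'I_n) :
  (forall x, f x != x -> x \in s) -> #|nonfixed f| <= size s.
Proof.
move=> sP; apply: leq_trans (card_size s).
by apply/subset_leq_card/subsetP => x; rewrite inE; apply: sP.
Qed.

(** Each point that the product moves has to be the source of a letter, namely
    of the first letter that moves its token; this bounds word length from
    below. *)
Lemma card_nonfixed_le w : #|nonfixed (tprod w)| <= size w.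
Proof.
by rewrite -(size_map fst); apply: nonfixed_le_size => x /mem_sources.
Qed.

(** The first letter merges the tokens of its source and its target. *)
Lemma tprod_neq_id w : irreflexive e -> arc_word w -> w != [::] ->
  exists a, tprod w a != a.
Proof.
move=> eI; case: w => [//|[a b] w] /= /andP[eab _] _.
have /eqP aNb : a != b by apply: contraTneq eab => ->; rewrite eI.
have [E|Na] := eqVneq (tprod ((a, b) :: w) a) a; last by exists a.
exists b; apply/eqP => Eb; case: aNb; rewrite -E -[RHS]Eb !tprod_cons eqxx.
by case: ifP.
Qed.

Fixpoint moves w x :=
  if w is (a, b) :: w' then (x == a) + moves w' (if x == a then b else x)
  else 0.

Lemma moves_gt0 w x : tprod w x != x -> 0 < moves w x.
Proof.
elim: w => [|[a b] w IHw] /=; first by rewrite tprod_nil eqxx.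
by rewrite tprod_cons; case: (x == a).
Qed.

(** A token that moves only once moves along an arc to its destination. *)
Lemma moves_gt1 w x : arc_word w -> tprod w x != x -> ~~ e x (tprod w x) ->
  1 < moves w x.
Proof.
elim: w => [|[a b] w IHw] /=; first by rewrite tprod_nil eqxx.
case/andP=> /= eab ew; rewrite tprod_cons.
case: (x =P a) => [-> _ nea|_]; last exact: IHw.
rewrite add1n ltnS; apply: moves_gt0; apply: contra nea => /eqP ->.
exact: eab.
Qed.

(** Tokens with distinct final positions are never together, so a letter moves
    at most one of them. *)
Lemma sum_moves_le w (s : seq 'I_n) :
  uniq (map (tprod w) s) -> \sum_(x <- s) moves w x <= size w.
Proof.
elim: w s => [|[a b] w IHw] s /=; first by rewrite big1.
move=> us; rewrite big_split /= -add1n leq_add //.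
  rewrite -big_mkcond /= sum1_count (count_uniq_mem a (map_uniq us)).
  exact: leq_b1.
rewrite -(big_map (fun x => if x == a then b else x) xpredT (moves w)).
apply: IHw; rewrite -map_comp (eq_map (g := tprod ((a, b) :: w))) // => x.
by rewrite tprod_cons.
Qed.

(** Whichever of the two single moves comes first puts both tokens on the same
    vertex. *)
Lemma no_swap_single_moves w x y : x != y ->
  tprod w x = y -> tprod w y = x -> moves w x = 1 -> moves w y != 1.
Proof.
elim: w x y => [//|[a b] w IHw] x y xNy /=; rewrite !tprod_cons.
have stay z : moves w z = 0 -> tprod w z = z.
  by move=> mz; apply/eqP; apply: contra_eqT mz => /moves_gt0; case: moves.
have [Ex | _] := eqVneq x a; have [Ey | _] := eqVneq y a; last exact: IHw.
- by rewrite Ex Ey eqxx in xNy.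
- move=> wb wy [/stay wbb]; case/eqP: xNy.
  by rewrite -[LHS]wy -[in LHS]wb wbb -wb wbb.
move=> wx wb _; apply/eqP => -[/stay wbb]; case/eqP: xNy.
by rewrite -[RHS]wx -[in RHS]wb wbb -wb wbb.
Qed.
End Words.

(** * Closed digraphs, (star) and (star star) *)

Section Structure.
Set Implicit Arguments.
Unset Strict Implicit.
Unset Printing Implicit Defensive.
Variables (n : nat) (e : rel 'I_n).
Hypothesis eI : irreflexive e.

Lemma arc_neq a b : e a b -> a != b.
Proof. by apply: contraTneq => ->; rewrite eI. Qed.

Definition strong x y := connect e x y && connect e y x.

Lemma strong_componentE C x y :
  C \in strong_components e -> x \in C -> (y \in C) = strong x y.
Proof.
case/imsetP => r _ ->; rewrite !inE /= /strong => /andP[rx xr].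
apply/idP/idP => /andP[h1 h2].
  by rewrite (connect_trans xr h1) (connect_trans h2 rx).
by rewrite (connect_trans rx h1) (connect_trans h2 xr).
Qed.

Lemma strong_component_of x :
  exists2 C, C \in strong_components e & x \in C.
Proof.
exists [set y in [set: 'I_n] | connect e x y && connect e y x].
  by apply/imsetP; exists x.
by rewrite !inE connect0.
Qed.

(** An arc inside a strong component lies on a directed cycle, so a closed
    digraph also has the opposite arc. *)
Lemma closed_sym a b :
  closed_digraph e -> e a b -> connect e b a -> e b a.
Proof.
move=> cl eab /connectP[p0 ep0 Ea]; rewrite cl /digraph_closure eab /=.
case/shortenP: ep0 Ea => p ep up _ Ea; apply/orP; right.
have uc : uniq (a :: belast b p) by rewrite Ea cons_uniq -rcons_uniq -lastI.
have sc : size (a :: belast b p) < n.+1.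
  by rewrite ltnS -[X in _ <= X]card_ord -(card_uniqP uc) max_card.
apply/existsP; exists (Ordinal sc); apply/existsP.
exists (in_tuple (a :: belast b p)); rewrite /ucycleb uc inE eqxx /= andbT.
have -> : rcons (belast b p) a = b :: p by rewrite Ea -lastI.
rewrite /= eab ep /=.
by case: p Ea {ep up uc sc} => [Ea|y p _]; rewrite /= eqxx // Ea eI in eab *.
Qed.

(** Arcs v -> a -> z put z at distance two from v as soon as z is neither v nor
    an out-neighbour of v, so (star) confines the arcs that leave a and z. *)
Lemma star_out v a z u : star_property e ->
  e v a -> e a z -> v != z -> ~~ e v z -> e a u || e z u -> u \in [:: v; a; z].
Proof.
move=> st eva eaz vNz nvz eu.
have ua := arc_neq eva; have uz := arc_neq eaz.
have /subsetP/(_ u) : out_nbrs e [set a; z] \subset [set v; a; z].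
  apply: (st); first by rewrite /dipath /= eva eaz !inE negb_or ua vNz uz.
  split.
    by exists [:: a; z]; rewrite /dipath /= eva eaz !inE negb_or ua vNz uz.
  case=> [|y [|//]] /=; first by move=> _ E; rewrite E eqxx in vNz.
  by rewrite /dipath /= andbT => /andP[evy _] E; rewrite -E evy in nvz.
rewrite !inE -orbA; apply; apply/bigcupP.
by case/orP: eu => eu; [exists a | exists z]; rewrite !inE ?eqxx ?orbT.
Qed.

(** Three strongly connected vertices force their strong component to be
    terminal of size three, so no arc leaves them. *)
Lemma three_strong_closed x y z w u : star_star_property e ->
  uniq [:: x; y; z] -> strong x y -> strong x z ->
  w \in [:: x; y; z] -> e w u -> u \in [:: x; y; z].
Proof.
move=> sst U xy xz wT ewu.
have [C Csc xC] := strong_component_of x.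
have yC : y \in C by rewrite (strong_componentE _ Csc xC).
have zC : z \in C by rewrite (strong_componentE _ Csc xC).
have sTC : {subset [:: x; y; z] <= C}.
  by move=> t; rewrite !inE => /or3P[] /eqP->.
have le3 : 3 <= #|C|.
  by have := uniq_leq_size U (s2 := enum C); rewrite -cardE; apply => t;
     rewrite mem_enum; apply: sTC.
have [sn st] := sst C Csc.
have nnt : ~ ~ terminal e C by move/sn; rewrite leqNgt le3.
have C3 : #|C| = 3.
  apply/eqP; rewrite eqn_leq le3 andbT.
  by case: leqP => // lt3; case: nnt => /st; rewrite leqNgt lt3.
apply: contraT => uT.
have uC : u \notin C.
  have sz : size (enum C) <= size [:: x; y; z] by rewrite -cardE C3.
  have sT' : {subset [:: x; y; z] <= enum C} by move=> t /sTC; rewrite mem_enum.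
  by have [_ E] := uniq_min_size U sT' sz; rewrite -mem_enum -E.
case: nnt => T; apply: T.
have [C' C'sc uC'] := strong_component_of u.
exists C'; split => //; first by apply: contraNneq uC => <-.
by exists w, u; split => //; apply: sTC.
Qed.

End Structure.

(** * Building short words *)

Section Sufficiency.
Set Implicit Arguments.
Unset Strict Implicit.
Unset Printing Implicit Defensive.
Variables (n : nat) (e : rel 'I_n).
Implicit Types (f g : transf n) (w : seq ('I_n * 'I_n)).
Hypotheses (eI : irreflexive e) (cl : closed_digraph e).
Hypotheses (st : star_property e) (sst : star_star_property e).

Definition one_stop f := forall v, f v = v \/ e v (f v) \/
  exists m, [/\ e v m, e m (f v) & f m = f v].

(** The vertex z is where one of the two swapped tokens can be parked: there is
    an arc from x or y to z, and the token of z shares the destination of the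
    parked one.  The condition [e z (f z)] says that z is not among the points
    that [peel] fixes for lack of an arc to their image. *)
Definition swaps_have_tail f := forall x y, x != y -> f x = y -> f y = x ->
  exists z, [/\ z \notin [:: x; y], e z (f z) &
    (e y z && (f z == x)) || (e x z && (f z == y))].

Definition no_3cycle f :=
  forall x y z, uniq [:: x; y; z] -> f x = y -> f y = z -> f z <> x.

Definition peelable f := [/\ one_stop f, swaps_have_tail f & no_3cycle f].

Lemma peelable_id : peelable (tprod [::]).
Proof.
split=> [v|x y xNy|x y z /= U]; rewrite ?tprod_nil; first by left.
  by move=> E; rewrite E eqxx in xNy.
by move=> E; rewrite E inE eqxx in U.
Qed.

Lemma one_stop_connect f v : one_stop f -> connect e v (f v).
Proof.
move=> /(_ v)[->|[evf|[m [evm emf _]]]]; first exact: connect0.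
  exact: connect1.
exact: connect_trans (connect1 evm) (connect1 emf).
Qed.

Section PrefixArc.
Variables (a b : 'I_n) (f g : transf n).
Hypotheses (eab : e a b) (gE : forall x, g x = f (if x == a then b else x)).

Let ga : g a = f b. Proof. by rewrite gE eqxx. Qed.
Let gN x : x != a -> g x = f x. Proof. by rewrite gE => /negPf->. Qed.
Let bNa : b != a. Proof. by rewrite eq_sym (arc_neq eI). Qed.

(** The token of a may stop over at b if there is an arc from b to f b, and
    otherwise at the stop m of b, as (star) supplies the arc from a to m.  If v
    stops over at a on its way to z, then (star) leaves only v and z as values
    of b; when b = z, the token of z is fixed, since otherwise a and z would be
    swapped by f and the tail of this swap could only be v, which has no arc to
    z. *)
Lemma one_stop_prefix : one_stop f -> swaps_have_tail f -> one_stop g.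
Proof.
move=> f1 f2 v; have [-> {v}|vNa] := eqVneq v a.
  rewrite ga; have [->|fbNa] := eqVneq (f b) a; first by left.
  case eafb: (e a (f b)); first by right; left.
  right; right; case: (f1 b) => [E|[ebf|[m [ebm emf fm]]]].
  - by rewrite E eab in eafb.
  - by exists b; rewrite gN.
  have mNa : m != a by apply: contraFneq eafb => <-.
  exists m; rewrite gN //; split=> //; apply: contraFT eafb => neam.
  have := star_out eI st eab ebm _ neam (u := f b).
  rewrite eq_sym mNa emf orbT !inE (negPf fbNa) => /(_ isT isT)/= /orP[]/eqP E.
    by rewrite E.
  by rewrite E eI in emf.
rewrite (gN vNa); case: (f1 v) => [->|[evf|[m [evm emf fm]]]].
- by left.
- by right; left.
have [Em|mNa] := eqVneq m a; last by right; right; exists m; rewrite gN.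
move: evm emf fm; rewrite {m}Em => eva; set z := f v => eaz faz.
have [E|zNv] := eqVneq z v; [by left | right].
case evz: (e v z); [by left | right].
exists a; split=> //; rewrite ga.
have out u : e a u || e z u -> u \in [:: v; a; z].
  by apply: (star_out eI st eva eaz); rewrite ?evz // eq_sym.
have nezv : e z v = false.
  apply: contraFF evz => ezv; apply: closed_sym ezv _ => //.
  exact: connect_trans (connect1 eva) (connect1 eaz).
have := out b; rewrite eab !inE (negPf bNa) => /(_ isT)/= /orP[]/eqP-> //.
case: (f1 z) => [//|[ezf|[m [ezm emf fm]]]].
  have := out (f z); rewrite ezf orbT !inE => /(_ isT) /or3P[]/eqP E //.
    by rewrite E nezv in ezf.
  have [t [tN etf tE]] := f2 a z (arc_neq eI eaz) faz E.
  have et : e a t || e z t by case/orP: tE => /andP[-> _]; rewrite ?orbT.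
  have := out t et; move: tN; rewrite !inE negb_or.
  by case/andP=> /negPf-> /negPf->; rewrite !orbF => /eqP Et;
    rewrite Et evz in etf.
have := out m; rewrite ezm orbT !inE => /(_ isT) /or3P[]/eqP E.
- by rewrite E nezv in ezm.
- by rewrite -fm E.
by rewrite E eI in ezm.
Qed.

(** A new swap of a with y has b as its tail.  An old swap whose tail is a keeps
    a as its tail, because a and the two swapped vertices fill a strong
    component, so that b is one of the two. *)
Lemma swaps_have_tail_prefix :
  one_stop f -> swaps_have_tail f -> swaps_have_tail g.
Proof.
move=> f1 f2; have g1 := one_stop_prefix f1 f2.
have at_end x y : x != y -> x = a -> g x = y -> g y = x ->
    exists z, [/\ z \notin [:: x; y], e z (g z) & e x z && (g z == y)].
  move=> xNy Ex gx gy.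
  have yNa : y != a by rewrite -Ex eq_sym.
  have fy : f y = x by rewrite -gN.
  have fb : f b = y by rewrite -ga -Ex.
  have bNy : b != y by apply: contraNneq xNy => E; rewrite -fy -{1}E fb.
  have exb : e x b by rewrite Ex.
  have yx : connect e y x by rewrite -fy one_stop_connect.
  have by_ : connect e b y by rewrite -fb one_stop_connect.
  have bNx : b != x by rewrite Ex.
  have U : uniq [:: x; y; b].
    by rewrite /= !inE !negb_or xNy eq_sym bNx eq_sym bNy.
  have out := three_strong_closed sst U.
  have xy' : strong e x y by rewrite /strong yx -{1}gx one_stop_connect.
  have xb' : strong e x b.
    by rewrite /strong (connect1 exb) (connect_trans by_ yx).
  have eby : e b y.
    case: (f1 b) => [E|[|[m [ebm emy fm]]]]; rewrite ?fb //.
      by rewrite E in fb; rewrite fb eqxx in bNy.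
    rewrite fb in emy fm.
    have := out b m xy' xb'; rewrite !inE eqxx !orbT.
    move=> /(_ isT ebm)/or3P[]/eqP E.
    - rewrite E in fm; have [t [tN etf tE]] := f2 x y xNy fm fy.
      have : t \in [:: x; y; b].
        by case/orP: tE => /andP[et _]; apply: out et; rewrite ?inE ?eqxx ?orbT.
      move: tN; rewrite !inE negb_or => /andP[/negPf-> /negPf->] /= /eqP Et.
      by rewrite Et fb in etf.
    - by rewrite E eI in emy.
    by rewrite E eI in ebm.
  by exists b; rewrite gN // fb eqxx exb eby !inE negb_or bNx bNy.
have at_tail x y : x != y -> f x = y -> f y = x -> a \notin [:: x; y] ->
    e y a -> f a = x -> e a x ->
    e a (g a) && ((e y a && (g a == x)) || (e x a && (g a == y))).
  move=> xNy fx fy; rewrite !inE negb_or => /andP[aNx aNy] eya fa eax.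
  have xy : connect e x y by rewrite -fx one_stop_connect.
  have yx : connect e y x by rewrite -fy one_stop_connect.
  have xa : connect e x a by apply: connect_trans xy (connect1 eya).
  have ay : connect e a y by apply: connect_trans (connect1 eax) xy.
  have eay : e a y by apply: closed_sym eya ay.
  have exa : e x a by apply: closed_sym eax xa.
  have U : uniq [:: x; y; a].
    by rewrite /= !inE !negb_or xNy eq_sym aNx eq_sym aNy.
  have := three_strong_closed sst U _ _ _ eab (x := x) (y := y).
  rewrite /strong xy yx xa (connect1 eax) !inE eqxx !orbT (negPf bNa) orbF.
  case/(_ isT isT isT)/orP => /eqP E; rewrite ga E ?fx ?fy.
    by rewrite eay exa eqxx orbT.
  by rewrite eax eya eqxx.
move=> x y xNy gx gy; have [Ex|xNa] := eqVneq x a.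
  have [z [zN ez /andP[exz gz]]] := at_end x y xNy Ex gx gy.
  by exists z; rewrite exz gz orbT.
have [Ey|yNa] := eqVneq y a.
  have yNx : y != x by rewrite eq_sym.
  have [z [zN ez /andP[exz gz]]] := at_end y x yNx Ey gy gx.
  by exists z; rewrite exz gz; split=> //; move: zN; rewrite !inE orbC.
rewrite gN // in gx; rewrite gN // in gy.
have [z [zN ez zE]] := f2 x y xNy gx gy.
have [Ez|zNa] := eqVneq z a; last by exists z; rewrite gN.
exists a; rewrite -{1}Ez zN; rewrite Ez in zN ez zE.
case/orP: zE => /andP[ea /eqP fa]; rewrite fa in ez.
  by have /andP[] := at_tail x y xNy gx gy zN ea fa ez.
have zN' : a \notin [:: y; x] by move: zN; rewrite !inE orbC.
have yNx : y != x by rewrite eq_sym.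
by have /andP[] := at_tail y x yNx gy gx zN' ea fa ez; rewrite orbC.
Qed.

(** Three cyclically permuted vertices form a strong component that no arc
    leaves; if a is one of them, so is b, and then the tokens of a and b share
    their destination. *)
Lemma no_3cycle_prefix : peelable f -> no_3cycle g.
Proof.
case=> f1 f2 f3; have g1 := one_stop_prefix f1 f2.
have at_end x y z :
    uniq [:: x; y; z] -> g x = y -> g y = z -> g z = x -> x != a.
  move=> U gx gy gz; apply/eqP => Ex.
  have xy : connect e x y by rewrite -gx one_stop_connect.
  have yz : connect e y z by rewrite -gy one_stop_connect.
  have zx : connect e z x by rewrite -gz one_stop_connect.
  have := three_strong_closed sst U _ _ _ eab.
  rewrite /strong xy zx (connect_trans xy yz) (connect_trans yz zx) -Ex.
  rewrite !inE eqxx /= => /(_ isT isT isT).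
  move: U; rewrite /= !inE negb_or andbT => /andP[/andP[xNy xNz] yNz].
  have fb : f b = y by rewrite -gx Ex ga.
  rewrite Ex (negPf bNa) /= => /orP[]/eqP Eb; rewrite Eb in fb.
    by case/eqP: yNz; rewrite -gy gN // -Ex eq_sym.
  by case/eqP: xNy; rewrite -gz -fb gN // -Ex eq_sym.
move=> x y z U gx gy gz.
have U1 : uniq [:: y; z; x] by rewrite -(rot_uniq 2).
have U2 : uniq [:: z; x; y] by rewrite -(rot_uniq 1).
have xNa := at_end _ _ _ U gx gy gz.
have yNa := at_end _ _ _ U1 gy gz gx.
have zNa := at_end _ _ _ U2 gz gx gy.
by apply: (f3 x y z U); rewrite -gN.
Qed.

End PrefixArc.

Lemma peelable_tprod w : arc_word e w -> peelable (tprod w).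
Proof.
elim: w => [|[a b] w IHw] /=; first by move=> _; exact: peelable_id.
case/andP=> /= eab /IHw pw; have [w1 w2 _] := pw.
have gE := tprod_cons a b w.
split; first exact: one_stop_prefix gE w1 w2.
  exact: swaps_have_tail_prefix gE w1 w2.
exact: no_3cycle_prefix gE pw.
Qed.

Definition reset f a : transf n := [ffun x => if x == a then a else f x].

Lemma resetE f a x : reset f a x = if x == a then a else f x.
Proof. by rewrite ffunE. Qed.

(** Fixing a may spoil the stop of another vertex or the tail of a swap.
    Neither happens if a has no arc to f a, as stops and tails do have one.  If
    every moved vertex has an arc to its image then no stop is relied upon, and it
    suffices that f a is fixed or that a is itself swapped with f a. *)
Lemma peelable_reset f a : peelable f ->
  ~~ e a (f a) \/ (forall v, f v = v \/ e v (f v)) /\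
                  (f (f a) = f a \/ f (f a) = a) ->
  peelable (reset f a).
Proof.
move=> [f1 f2 f3] H.
have resetN x y : x != y -> reset f a x = y -> reset f a y = x ->
    [/\ x != a, y != a, f x = y & f y = x].
  rewrite !resetE; have [->|_] := eqVneq x a.
    by move=> + E; rewrite E eqxx.
  by have [->|_] := eqVneq y a; first by move=> + _ E; rewrite E eqxx.
split=> [v|x y xNy rx ry|x y z U].
- rewrite !resetE; have [|vNa] := eqVneq v a; first by left.
  case: H => [na|[/(_ v)[]]]; [|by left|by right; left].
  case: (f1 v) => [|[|[m [evm emf fm]]]]; [by left|by right; left|right; right].
  exists m; rewrite resetE; have [Em|_] := eqVneq m a; last by [].
  by rewrite -Em fm emf in na.
- have [xNa yNa fx fy] := resetN x y xNy rx ry.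
  have [z [zN ez zE]] := f2 x y xNy fx fy.
  exists z; rewrite !resetE; have [Ez|//] := eqVneq z a.
  case: H => [na|[_ H]]; first by rewrite -Ez ez in na.
  rewrite -Ez in H xNa yNa.
  case/orP: zE => /andP[_ /eqP fz]; rewrite fz ?fx ?fy in H;
    by case: H => E; rewrite E eqxx in xNy xNa yNa *.
rewrite !resetE; move: U; rewrite /= !inE negb_or andbT.
case/andP=> /andP[xNy xNz] yNz.
have [Ex|xNa] := eqVneq x a; first by move=> E; rewrite Ex E eqxx in xNy.
have [Ey|yNa] := eqVneq y a; first by move=> _ E; rewrite Ey E eqxx in yNz.
have [Ez|zNa] := eqVneq z a; first by move=> _ _ E; rewrite Ez E eqxx in xNz.
by apply: f3; rewrite /= !inE negb_or xNy xNz yNz.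
Qed.

(** A moved vertex v with a minimal set of reachable vertices is strongly
    connected to all its iterated images, which lie in a component of size at
    most three. *)
Lemma exists_swap f : one_stop f -> no_3cycle f -> (exists v, f v != v) ->
  (forall v, f v != v -> e v (f v) /\ f (f v) != f v) ->
  exists x y, [/\ x != y, f x = y & f y = x].
Proof.
move=> f1 f3 [v0 v0N] H.
have := @arg_minnP _ v0 (fun v => f v != v) (fun v => #|connect e v|) v0N.
case=> v vN vmin.
have back u : f u != u -> connect e v u -> connect e u v.
  move=> uN vu; have sub : connect e u \subset connect e v.
    by apply/subsetP => t; apply: connect_trans.
  have /subset_cardP/(_ sub) E' : #|connect e u| = #|connect e v|.
    by apply/eqP; rewrite eqn_leq vmin // subset_leq_card.
  by have := E' v; rewrite !inE /= connect0.
have [e0 N1] := H v vN; have [e1 N2] := H _ N1; have [e2 _] := H _ N2.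
have [E2|N02] := eqVneq (f (f v)) v; first by exists v, (f v); rewrite eq_sym.
have v1 : strong e v (f v) by rewrite /strong (connect1 e0) back // connect1.
have c2 : connect e v (f (f v)) := connect_trans (connect1 e0) (connect1 e1).
have v2 : strong e v (f (f v)) by rewrite /strong c2 back.
have U : uniq [:: v; f v; f (f v)].
  by rewrite /= !inE negb_or eq_sym vN eq_sym N02 eq_sym N1.
have := three_strong_closed sst U v1 v2 _ e2.
rewrite !inE eqxx !orbT => /(_ isT)/or3P[]/eqP E.
- by case: (f3 _ _ _ U erefl erefl E).
- by exists (f v), (f (f v)); rewrite eq_sym.
by rewrite E eqxx in N2.
Qed.

(** The point a to fix is, in order of preference, one without an arc to its
    image, one whose image is fixed, or a swapped one that has an arc to the
    tail of the swap. *)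
Lemma peel f : peelable f -> (exists v, f v != v) ->
  exists a b, [/\ f a != a, e a b, f b = f a & peelable (reset f a)].
Proof.
move=> pf exN; have [f1 f2 f3] := pf.
have [/existsP[v /andP[vN nev]]|far] :=
  boolP [exists v, (f v != v) && ~~ e v (f v)].
  case: (f1 v) => [E|[E|[m [evm emf fm]]]].
  - by rewrite E eqxx in vN.
  - by rewrite E in nev.
  by exists v, m; split=> //; apply: peelable_reset => //; left.
have near v : f v != v -> e v (f v).
  by move=> vN; move/existsPn/(_ v): far; rewrite vN /= negbK.
have near' v : f v = v \/ e v (f v).
  by have [->|/near] := eqVneq (f v) v; [left | right].
have [/existsP[a /andP[aN /eqP ffa]]|noend] :=
  boolP [exists a, (f a != a) && (f (f a) == f a)].
  exists a, (f a); split=> //; first exact: near.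
  by apply: peelable_reset => //; right; split=> //; left.
have [|x [y [xNy fx fy]]] := exists_swap f1 f3 exN.
  move=> v vN; split; first exact: near.
  by move/existsPn/(_ v): noend; rewrite vN.
have [z [zN ezf zE]] := f2 x y xNy fx fy.
have [yNx yN] : y != x /\ f y != y by rewrite fy eq_sym.
case/orP: zE => /andP[ez /eqP fz].
  exists y, z; split=> //; first by rewrite fz.
  by apply: peelable_reset => //; right; split=> //; right; rewrite fy.
exists x, z; split=> //; rewrite ?fx ?fz //.
by apply: peelable_reset => //; right; split=> //; right; rewrite fx.
Qed.

Lemma peelable_word f : peelable f ->
  exists w, [/\ arc_word e w, tprod w = f & size w = #|nonfixed f|].
Proof.
move Ek : #|nonfixed f| => k; elim: k f Ek => [|k IHk] f Ek pf.
  exists [::]; split=> //; apply/ffunP => x; rewrite tprod_nil.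
  by apply/esym/eqP; have := card0_eq Ek x; rewrite !inE => /negbFE.
have [|a [b [aN eab fb pr]]] := peel pf.
  have /card_gt0P[v] : 0 < #|nonfixed f| by rewrite Ek.
  by rewrite inE; exists v.
have [|w [ew wE sw]] := IHk (reset f a) _ pr.
  apply/eqP; rewrite -eqSS -Ek (cardsD1 a (nonfixed f)) inE aN eqSS.
  apply/eqP/eq_card => x; rewrite !inE resetE.
  by have [->|] := eqVneq x a; rewrite ?eqxx.
exists ((a, b) :: w); rewrite /= eab sw; split=> //; apply/ffunP => x.
rewrite tprod_cons wE resetE.
have [->|xNa] := eqVneq x a; last by rewrite (negPf xNa).
by rewrite fb eq_sym (negPf (arc_neq eI eab)).
Qed.

End Sufficiency.

(** * Products that need long words *)

Section Necessity.
Set Implicit Arguments.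
Unset Strict Implicit.
Unset Printing Implicit Defensive.
Variables (n : nat) (e : rel 'I_n).
Hypothesis eI : irreflexive e.

(** Equality of word length and number of moved points throughout the semigroup,
    freed from the membership proof on which [word_length] depends. *)
Definition tight := forall w, arc_word e w -> w != [::] ->
  exists w', [/\ arc_word e w', tprod w' = tprod w
               & size w' = #|nonfixed (tprod w)|].

Lemma product_of_lengthP (f : transf n) k :
  reflect (exists w, [/\ arc_word e w, tprod w = f & size w = k])
          (product_of_length e f k).
Proof.
apply: (iffP existsP) => [[w /andP[ew /eqP wf]]|[w [ew wf <-]]].
  by exists w; rewrite size_tuple.
by exists (in_tuple w); rewrite wf eqxx andbT.
Qed.

(** The arcs of the path y :: q, from the last to the first: an inner vertex is
    vacated before it is entered, so every token moves one step only. *)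
Fixpoint shift_word (y : 'I_n) q :=
  if q is z :: q' then rcons (shift_word z q') (y, z) else [::].

Lemma arc_shift_word y q : path e y q -> arc_word e (shift_word y q).
Proof.
elim: q y => [//|z q IHq] y /= /andP[eyz /IHq eq].
by rewrite /arc_word all_rcons /= eyz.
Qed.

Lemma tprod_shift_word y p b x : uniq (rcons (y :: p) b) ->
  tprod (shift_word y (rcons p b)) x = next_at x b y p.
Proof.
elim: p y => [|z p IHp] y /=; first by rewrite tprod_cons tprod_nil.
rewrite inE mem_rcons inE !negb_or; case/andP => /and3P[yNz yNb yNp] U.
rewrite -cats1 tprod_cat (IHp _ U) tprod_cons tprod_nil.
have [->|xNy] := eqVneq x y.
  have -> : next_at y b z p = y; last by rewrite eqxx.
  elim: p z yNz yNp {IHp U} => [|t p IHp] z yNz /=.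
    by rewrite (negPf yNz).
  by rewrite (negPf yNz) inE negb_or => /andP[yNt]; apply: IHp.
suff /negPf-> : next_at x b z p != y by [].
elim: p z yNz yNp {IHp U} => [|t p IHp] z yNz /=.
  by case: (x == z); rewrite // eq_sym.
rewrite inE negb_or => /andP[yNt yNp].
by case: (x == z); [rewrite eq_sym | apply: IHp].
Qed.

(** On the cycle b, a, p, the word s first merges the token of b into that of a
    and then shifts all tokens by one.  Thus s is the contraction of a to b
    followed by the rotation of the cycle b, p from which a is left out, and its
    power by the length of that shorter cycle is the contraction alone. *)
Lemma arc_of_dicycle a b : e b a -> on_dicycle e b a ->
  exists w, [/\ arc_word e w, w != [::] & tprod w = Defs.arc a b].
Proof.
move=> eba /existsP[k /existsP[c /and3P[/andP[cyc uc] bc /eqP nxt]]].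
case: (rot_to bc) => i c' Ec.
have uc' : uniq (b :: c') by rewrite -Ec rot_uniq.
have cyc' : cycle e (b :: c') by rewrite -Ec rot_cycle.
have {nxt} : next (b :: c') b = a by rewrite -Ec next_rot.
case: c' {Ec} uc' cyc' => [|a' p] U P /=; rewrite eqxx => E.
  by rewrite E eI in eba.
rewrite {a'}E in U P; move: P; rewrite /= => /andP[_ P].
set s := (b, a) :: shift_word a (rcons p b).
have es : arc_word e s by rewrite /= eba arc_shift_word.
have [aNb ap bp up] : [/\ a != b, a \notin p, b \notin p & uniq p].
  by move: U; rewrite /= inE negb_or eq_sym => /and3P[/andP[-> ->] -> ->].
have U' : uniq (rcons (a :: p) b).
  by rewrite rcons_uniq inE negb_or eq_sym aNb bp /= ap up.
have ub : uniq (b :: p) by rewrite /= bp.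
have sE x : tprod s x = next (b :: p) (if x == a then b else x).
  rewrite tprod_cons tprod_shift_word //=.
  have [->|xNb] := eqVneq x b; last have [->|xNa] := eqVneq x a.
  - by rewrite eq_sym (negPf aNb); case: (p) => [|z q] /=; rewrite !eqxx.
  - by case: (p) => [|z q] /=; rewrite !eqxx.
  by case: (p) => [|z q] /=; rewrite (negPf xNa) (negPf xNb).
have nNa x : x != a -> next (b :: p) x != a.
  move=> xNa; have [xbp|xbp] := boolP (x \in b :: p).
    have : next (b :: p) x \in b :: p by rewrite mem_next.
    by apply: contraTneq => ->; rewrite inE negb_or aNb.
  by rewrite next_nth (negPf xbp).
(* No value of s is a, so only the first contraction has an effect. *)
have itE j x : iter j.+1 (tprod s) x
             = iter j.+1 (next (b :: p)) (if x == a then b else x).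
  elim: j x => [|j IHj] x; first exact: sE.
  rewrite iterSr IHj sE [RHS]iterSr.
  set y := if x == a then b else x.
  have yNa : y != a by rewrite /y; case: ifP => [_|/negbT]; rewrite // eq_sym.
  by rewrite (negPf (nNa _ yNa)).
exists (flatten (nseq (size p).+1 s)); split=> //.
  by apply/allP => l /flattenP[t /nseqP[-> _]]; apply: (allP es).
apply/ffunP => x; rewrite tprod_flatten_nseq itE ffunE.
set y := if x == a then b else x.
have [ybp|ybp] := boolP (y \in b :: p).
  have cb := cycle_next ub.
  by rewrite -[in RHS](iter_order_cycle cb ybp ybp) (order_cycle cb ub ybp).
have yfix : next (b :: p) y = y by rewrite next_nth (negPf ybp).
by elim: (size p).+1 => //= j ->.
Qed.

Lemma arc_inj (a b c d : 'I_n) :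
  a != b -> Defs.arc c d = Defs.arc a b -> c = a /\ d = b.
Proof.
move=> aNb /ffunP E; have := E a; rewrite !ffunE eqxx.
have [->|_ Eab] := eqVneq a c; last by rewrite Eab eqxx in aNb.
by [].
Qed.

Lemma tight_closed : tight -> closed_digraph e.
Proof.
move=> T a b; rewrite /digraph_closure; case eab: (e a b) => //=.
apply/esym/negP => /andP[eba cyc].
have [w [ew w0 wE]] := arc_of_dicycle eba cyc.
have aNb : a != b by rewrite eq_sym (arc_neq eI).
have [w' []] := T w ew w0; rewrite {}wE => ew' w'E sw'.
have nf : nonfixed (Defs.arc a b) = [set a].
  apply/setP => x; rewrite !inE ffunE; have [->|_] := eqVneq x a.
    by rewrite eq_sym.
  by rewrite eqxx.
move: sw' ew' w'E; rewrite nf cards1; case: w' => [|[c d] [|//]] //= _.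
rewrite andbT => ecd /ffunP wE; have [|Ec Ed] := @arc_inj a b c d aNb.
  by apply/ffunP => x; rewrite -wE tprod_cons tprod_nil ffunE.
by rewrite Ec Ed eab in ecd.
Qed.

(** The letters moving the token of x and those moving the token of y are
    disjoint sets of size at least two and at least one, the latter being at
    least two if y has no arc to its image. *)
Lemma tight_two_tokens w x y : tight -> arc_word e w -> w != [::] ->
  tprod w x != tprod w y -> tprod w x != x -> ~~ e x (tprod w x) ->
  tprod w y != y -> 3 + ~~ e y (tprod w y) <= #|nonfixed (tprod w)|.
Proof.
move=> T ew w0 xy xN nex yN; have [w' [ew' wE <-]] := T w ew w0.
rewrite -!wE in xy xN nex yN *.
have sm : moves w' x + moves w' y <= size w'.
  have := @sum_moves_le _ w' [:: x; y].
  by rewrite /= !big_cons big_nil addn0 inE xy; apply.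
apply: leq_trans sm; have mx := moves_gt1 ew' xN nex.
case: (boolP (e y _)) => ey; first exact: (leq_add mx (moves_gt0 yN)).
exact: (leq_add mx (moves_gt1 ew' yN ey)).
Qed.

(** If v1 -> u escapes, sending v0 to v2 and v1 to u moves two points but takes
    three moves.  If only v2 -> u escapes, sending v0 to v2 and both v1 and v2
    to u moves three points but takes four moves. *)
Lemma tight_star : tight -> star_property e.
Proof.
move=> T v0 v1 v2; rewrite /dipath /= !inE !negb_or !andbT.
case/andP=> /andP[e01 e12] /andP[/andP[v01 v02] v12] [_ dmin].
have ne02 : ~~ e v0 v2.
  apply/negP => e02; have := dmin [:: v2].
  by rewrite /dipath /= e02 inE v02 => /(_ isT erefl).
have out1 u : e v1 u -> u \in [set v0; v1; v2].
  move=> e1u; apply: contraT; rewrite !inE !negb_or => /andP[/andP[u0 u1] u2].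
  set w := [:: (v1, u); (v0, v1); (v1, v2)].
  have val x : tprod w x = if x == v0 then v2 else if x == v1 then u else x.
    rewrite !tprod_cons tprod_nil.
    have [->|x0] := eqVneq x v0; first by rewrite (negPf v01) !eqxx.
    have [_|x1] := eqVneq x v1; first by rewrite (negPf u0) (negPf u1).
    by rewrite (negPf x0) (negPf x1).
  have wv0 : tprod w v0 = v2 by rewrite val eqxx.
  have wv1 : tprod w v1 = u by rewrite val eq_sym (negPf v01) eqxx.
  have ew : arc_word e w by rewrite /= e01 e12 e1u.
  have := @tight_two_tokens w v0 v1 T ew isT.
  rewrite wv0 wv1 !(eq_sym v2) u2 v02 ne02 u1 e1u => /(_ isT isT isT isT).
  move=> lb; suff /(leq_trans lb) : #|nonfixed (tprod w)| <= 2 by [].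
  apply: (nonfixed_le_size (s := [:: v0; v1])) => x; rewrite val !inE.
  by case: (x == v0); case: (x == v1); rewrite // eqxx.
have out2 u : e v2 u -> u \in [set v0; v1; v2].
  move=> e2u; apply: contraT => uT; have := uT.
  rewrite !inE !negb_or => /andP[/andP[u0 u1] u2].
  have ne1u : ~~ e v1 u by apply: contra uT => /out1.
  set w := [:: (v1, v2); (v2, u); (v0, v1); (v1, v2)].
  have val x : tprod w x =
      if x == v0 then v2 else if x \in [:: v1; v2] then u else x.
    rewrite !tprod_cons tprod_nil !inE.
    have [->|x0] := eqVneq x v0.
      by rewrite (negPf v01) (negPf v02) !eqxx.
    have [_|x1] := eqVneq x v1.
      by rewrite eqxx (negPf u0) (negPf u1).
    have [_|x2] := eqVneq x v2; first by rewrite (negPf u0) (negPf u1).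
    by rewrite (negPf x0) (negPf x1).
  have wv0 : tprod w v0 = v2 by rewrite val eqxx.
  have wv1 : tprod w v1 = u by rewrite val eq_sym (negPf v01) inE eqxx.
  have ew : arc_word e w by rewrite /= e01 e12 e2u.
  have := @tight_two_tokens w v0 v1 T ew isT.
  rewrite wv0 wv1 !(eq_sym v2) u2 v02 ne02 u1 ne1u => /(_ isT isT isT isT).
  move=> lb; suff /(leq_trans lb) : #|nonfixed (tprod w)| <= 3 by [].
  apply: (nonfixed_le_size (s := [:: v0; v1; v2])) => x; rewrite val !inE.
  by case: (x == v0); case: (x == v1); case: (x == v2); rewrite // eqxx.
apply/subsetP => u /bigcupP[c]; rewrite !inE.
by case/orP => /eqP-> ecu; [have := out1 u ecu | have := out2 u ecu];
  rewrite !inE.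
Qed.

(** Transposing two vertices of a triangle needs the third vertex as a parking
    place; if the token of the third vertex must leave the triangle, the product
    costs one letter more than the number of moved points. *)
Lemma tight_triangle a b c d : tight -> uniq [:: a; b; c] ->
  e a c -> e b a -> e c b -> e c d -> d \in [:: a; b; c].
Proof.
move=> T U eac eba ecb ecd; apply: contraT.
rewrite !inE !negb_or => /and3P[dNa dNb dNc].
move: U; rewrite /= !inE negb_or andbT => /andP[/andP[aNb aNc] bNc].
set w := [:: (c, d); (a, c); (b, a); (c, b)].
have ew : arc_word e w by rewrite /= eac eba ecb ecd.
have [ba ca cb] : [/\ (b == a) = false, (c == a) = false & (c == b) = false].
  by rewrite (eq_sym b) !(eq_sym c) (negPf aNb) (negPf aNc) (negPf bNc).
have val x : tprod w x = if x == a then b else if x == b then a else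
                         if x == c then d else x.
  rewrite !tprod_cons tprod_nil.
  have [->|xa] := eqVneq x a.
    by rewrite (negPf aNc) eqxx cb eqxx.
  have [->|xb] := eqVneq x b.
    by rewrite (negPf bNc) ba eqxx (negPf aNc).
  have [_|xc] := eqVneq x c.
    by rewrite (negPf dNa) (negPf dNb) (negPf dNc).
  by rewrite (negPf xa) (negPf xb) (negPf xc).
have [w' [ew' wE sw]] := T w ew isT.
have wa : tprod w' a = b by rewrite wE val eqxx.
have wb : tprod w' b = a by rewrite wE val ba eqxx.
have wc : tprod w' c = d.
  by rewrite wE val ca cb eqxx.
have le3 : size w' <= 3.
  rewrite sw; apply: (nonfixed_le_size (s := [:: a; b; c])) => x.
  rewrite val !inE.
  by case: (x == a); case: (x == b); case: (x == c); rewrite // eqxx.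
have := @sum_moves_le _ w' [:: a; b; c].
rewrite /= !big_cons big_nil !inE wa wb wc ba.
rewrite ![_ == d]eq_sym (negPf dNa) (negPf dNb) => /(_ isT).
have := @moves_gt0 _ w' a; rewrite wa eq_sym aNb => /(_ isT).
have := @moves_gt0 _ w' b; rewrite wb aNb => /(_ isT).
have := @moves_gt0 _ w' c; rewrite wc dNc => /(_ isT).
move=> mc mb ma sm; have [ma1 mb1] : moves w' a = 1 /\ moves w' b = 1.
  by clear - ma mb mc sm le3; lia.
by have := no_swap_single_moves aNb wa wb ma1; rewrite mb1.
Qed.

Lemma exit_arc (S : {set 'I_n}) x y :
  connect e x y -> x \in S -> y \notin S ->
  exists u v, [/\ u \in S, v \notin S, e u v, connect e x u & connect e v y].
Proof.
case/connectP => p; elim: p x => [|z p IHp] x /= => [_ -> -> //|].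
case/andP=> exz ep Ey xS yS; have [zS|zS] := boolP (z \in S).
  have [u [v [uS vS euv zu vy]]] := IHp z ep Ey zS yS.
  by exists u, v; split=> //; apply: connect_trans (connect1 exz) zu.
by exists x, z; split=> //; apply/connectP; exists p.
Qed.

Lemma strong_exit_arc C (S : {set 'I_n}) :
  C \in strong_components e -> S \subset C -> 0 < #|S| < #|C| ->
  exists u v, [/\ u \in S, v \in C, v \notin S & e u v].
Proof.
move=> Csc SC /andP[/card_gt0P[x xS] ltSC].
have [y yC yS] : exists2 y, y \in C & y \notin S.
  by apply/subsetPn; apply: contraL ltSC => /subset_leq_card; rewrite -leqNgt.
have xC := subsetP SC x xS.
have /andP[xy yx] : strong e x y by rewrite -(strong_componentE _ Csc xC).
have [u [v [uS vS euv xu vy]]] := exit_arc xy xS yS.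
exists u, v; split=> //; rewrite (strong_componentE _ Csc xC) /strong.
by rewrite (connect_trans xu (connect1 euv)) (connect_trans vy yx).
Qed.

Lemma tight_star_star : tight -> star_star_property e.
Proof.
move=> T C Csc; have cl := tight_closed T; have st := tight_star T.
have sym x y : x \in C -> y \in C -> e x y -> e y x.
  move=> xC yC exy; apply: closed_sym exy _ => //.
  by move: yC; rewrite (strong_componentE _ Csc xC) => /andP[].
(* Two arcs from c span a path or a triangle; neither lets an arc escape. *)
have triple c p q u d : uniq [:: c; p; q] -> {subset [:: c; p; q] <= C} ->
    e c p -> e c q -> u \in [:: c; p; q] -> e u d -> d \in [:: c; p; q].
  move=> U sC ecp ecq uT eud.
  have [cC pC qC] : [/\ c \in C, p \in C & q \in C].
    by split; apply: sC; rewrite !inE eqxx ?orbT.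
  have epc := sym _ _ cC pC ecp; have eqc := sym _ _ cC qC ecq.
  have [pNq cNp cNq] : [/\ p != q, c != p & c != q].
    by move: U; rewrite /= !inE negb_or andbT => /andP[/andP[-> ->] ->].
  have perm_mem s : perm_eq s [:: c; p; q] -> d \in s -> d \in [:: c; p; q].
    by move/perm_mem->.
  have [epq|nepq] := boolP (e p q).
    have eqp := sym _ _ pC qC epq.
    move: uT; rewrite 3!inE => /or3P[]/eqP E; rewrite E in eud.
    + apply: (perm_mem [:: p; q; c]).
        exact: (permEl (perm_rot 1 [:: c; p; q])).
      apply: tight_triangle eud => //.
      by rewrite -(rot_uniq 2).
    + apply: (perm_mem [:: c; q; p]).
        by rewrite perm_cons; apply: (permEl (perm_rot 1 [:: p; q])).
      apply: tight_triangle eud => //.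
      by rewrite /= !inE negb_or cNq cNp eq_sym pNq.
    exact: tight_triangle eud.
  have neqp : ~~ e q p by apply: contra nepq; apply: sym.
  move: uT; rewrite 3!inE => /or3P[]/eqP E; rewrite E in eud.
  - apply: (perm_mem [:: p; c; q]).
      by rewrite (permEl (perm_catCA [:: p] [:: c] [:: q])).
    by apply: (star_out eI st epc ecq); rewrite ?eud.
  - apply: (perm_mem [:: q; c; p]).
      exact: (permEl (perm_rot 2 [:: c; p; q])).
    by apply: (star_out eI st eqc ecp); rewrite ?eud ?orbT // eq_sym.
  apply: (perm_mem [:: p; c; q]).
    by rewrite (permEl (perm_catCA [:: p] [:: c] [:: q])).
  by apply: (star_out eI st epc ecq); rewrite ?eud ?orbT.
(* Growing a vertex along exit arcs yields such a pair of arcs. *)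
have big : 2 < #|C| -> exists c p q, [/\ uniq [:: c; p; q],
    {subset [:: c; p; q] <= C}, e c p & e c q].
  move=> gt2; have /card_gt0P[x xC] : 0 < #|C| by apply: leq_trans gt2.
  have [||x' [y [/set1P-> yC]]] := @strong_exit_arc C [set x] Csc.
  - by rewrite sub1set.
  - by rewrite cards1 (ltnW gt2).
  rewrite inE eq_sym => xNy exy.
  have [||u [z [uS zC zS euz]]] := @strong_exit_arc C [set x; y] Csc.
  - by apply/subsetP => t /set2P[] ->.
  - by rewrite cards2 xNy.
  move: zS; rewrite !inE negb_or => /andP[zNx zNy].
  have eyx := sym x y xC yC exy.
  case/set2P: uS => E; rewrite E in euz.
    exists x, y, z; split=> //.
      by rewrite /= !inE negb_or xNy eq_sym zNx eq_sym zNy.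
    by move=> t; rewrite !inE => /or3P[]/eqP->.
  exists y, x, z; split=> //.
    by rewrite /= !inE negb_or eq_sym xNy eq_sym zNy eq_sym zNx.
  by move=> t; rewrite !inE => /or3P[]/eqP->.
have le3 : #|C| <= 3.
  rewrite leqNgt; apply/negP => gt3; have [|c [p [q [U sC ecp ecq]]]] := big.
    exact: ltnW.
  have [||u [v [uS vC vS euv]]] :=
      @strong_exit_arc C [set t in [:: c; p; q]] Csc.
  - by apply/subsetP => t; rewrite inE; apply: sC.
  - by rewrite cardsE (card_uniqP U).
  by rewrite inE in uS; rewrite inE (triple c p q u v) in vS.
split=> // nt; rewrite leqNgt; apply/negP => gt2.
have [c [p [q [U sC ecp ecq]]]] := big gt2.
case: nt => -[C' [C'sc C'NC [u [v [uC vC' euv]]]]].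
have eqC : [:: c; p; q] =i enum C.
  have sE : size (enum C) <= size [:: c; p; q] by rewrite -cardE.
  have sC' : {subset [:: c; p; q] <= enum C}.
    by move=> t /sC; rewrite mem_enum.
  by have [] := uniq_min_size U sC' sE.
have vC : v \in C.
  by rewrite -mem_enum -eqC (triple c p q u v) // eqC mem_enum.
case/eqP: C'NC; apply/setP => t.
by rewrite (strong_componentE _ C'sc vC') (strong_componentE _ Csc vC).
Qed.

Lemma word_length_tight :
  (forall (f : transf n) (h : in_arc_semigroup e f),
     word_length h = n - fix_card f) -> tight.
Proof.
move=> L w ew w0.
have h : in_arc_semigroup e (tprod w).
  exists (size w); rewrite lt0n size_eq0 w0.
  by apply/product_of_lengthP; exists w.
have := L _ h; rewrite sub_fix_card /word_length; case: ex_minnP => k.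
by case/andP=> _ /product_of_lengthP[w' [ew' wE <-]] _ sw; exists w'.
Qed.

End Necessity.

(** * The characterisation *)

Theorem theorem2p11 (n : nat) (e : rel 'I_n) (hn : 2 <= n)
    (e_irr : irreflexive e) (e_conn : connected_digraph e) :
  (forall (alpha : transf n) (h : in_arc_semigroup e alpha),
      word_length h = n - fix_card alpha) <->
  [/\ closed_digraph e, star_property e & star_star_property e].
Proof.
split=> [/word_length_tight T|[cl st sst] f h].
  split; [exact: tight_closed | exact: tight_star | exact: tight_star_star].
rewrite sub_fix_card /word_length; case: ex_minnP => k.
case/andP=> k0 /product_of_lengthP[w [ew wf wk]] kmin.
apply/eqP; rewrite eqn_leq -{2}wf -{2}wk card_nonfixed_le andbT.
have [w' [ew' w'f <-]] : exists w',
    [/\ arc_word e w', tprod w' = f & size w' = #|nonfixed f|].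
  by apply: peelable_word => //; rewrite -wf; apply: peelable_tprod.
apply: kmin; apply/andP; split; last by apply/product_of_lengthP; exists w'.
have w0 : w != [::] by rewrite -size_eq0 -lt0n wk.
have [a] := tprod_neq_id e_irr ew w0; rewrite wf -w'f => /mem_sources.
by case: (w').
Qed.
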